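(* Let $q$ be a power of an odd prime, let $m\ge 2$ and $\varepsilon\in\{+1,-1\}$, and suppose that either $m>2$, or $m=2$ and $\varepsilon=+1$. Let $G_2=\langle T_U,\mathcal{B}\rangle = T_U:\mathcal{B}$ be the group defined in the context. Then $G_2$ is a nonabelian group of order $q^{2m}$ in which the nonidentity elements can be partitioned into $D_0\cup D_1\cup D_2$, where each $D_i$ is a partial difference set in $G_2$, $\mathrm{Cay}(G_2,D_0)\cong \mathrm{VO}^\varepsilon(2m,q)$, and $\mathrm{Cay}(G_2,D_1)\cong\mathrm{Cay}(G_2,D_2)\cong\mathrm{VNO}^\varepsilon(2m,q)$.
   Context: Partial difference sets. A $(v,k,\lambda,\mu)$-partial difference set (PDS) in a finite group $G$ of order $v$ is a subset $D$ with $|D|=k$ such that every nonidentity element of $D$ can be written as $d_1d_2^{-1}$ with $d_1,d_2\in D$ in exactly $\lambda$ ways, and every nonidentity element of $G - D$ in exactly $\mu$ ways. PDSs are assumed regular: $1_G\notin D$ and $D=D^{-1}$. $\mathrm{Cay}(G,D)$ is the graph with vertex set $G$ in which $g,h$ are adjacent iff $gh^{-1}\in D$. Quadratic form. $V=\mathbb{F}_q^{2m}$ (row vectors, standard basis $e_1,\dots,e_{2m}$) carries the quadratic form $Q(x)=x_1x_2+x_3x_4+\cdots+x_{2m-1}x_{2m}$ if $\varepsilon=+1$, and $Q(x)=x_1x_2+\cdots+x_{2m-3}x_{2m-2}+x_{2m-1}^2+bx_{2m}^2$ with $-b$ a nonsquare in $\mathbb{F}_q$ if $\varepsilon=-1$.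 Graphs. $\mathrm{VO}^\varepsilon(2m,q)$ has vertex set $V$, distinct $u,w$ being adjacent iff $Q(u-w)=0$. $\mathrm{VNO}^\varepsilon(2m,q)$ has vertex set $V$, distinct $u,w$ being adjacent iff $Q(u-w)$ is a nonzero square in $\mathbb{F}_q$. Affine group. Elements of $\mathrm{AGL}(2m,q)$ are written $[M,u]$ with $M\in\mathrm{GL}(2m,q)$, $u\in V$, acting by $x^{[M,u]}=xM+u$, with product $[M_1,v_1][M_2,v_2]=[M_1M_2,v_1M_2+v_2]$. For a subspace $U\le V$, $T_U=\{[I,u]:u\in U\}$. The group $G_2$. For $\alpha\in\mathbb{F}_q$ let $$B_\alpha=\begin{pmatrix}1&0&0&0\\0&1&-\alpha&0\\0&0&1&0\\\alpha&0&0&1\end{pmatrix},\qquad A_\alpha=\begin{pmatrix}B_\alpha&0\\0&I_{2m-4}\end{pmatrix}$$ ($A_\alpha=B_\alpha$ if $m=2$). Let $U=\langle e_1,e_4,e_5,\dots,e_{2m}\rangle$ (spanned by all $e_i$ except $e_2,e_3$), $\mathcal{B}=\langle [A_\alpha,\alpha e_2+\beta e_3]:\alpha,\beta\in\mathbb{F}_q\rangle$, which normalizes $T_U$, and $G_2=\langle T_U,\mathcal{B}\rangle=T_U:\mathcal{B}$ (a semidirect product). *)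

(* Defs.v *)
From HB Require Import structures.
From mathcomp Require Import all_boot all_order all_algebra all_fingroup.

Set Implicit Arguments.
Unset Strict Implicit.
Unset Printing Implicit Defensive.

Import GRing.Theory.
Local Open Scope ring_scope.

Section PartialDifferenceSets.

Variable gT : finGroupType.
Implicit Types (G D : {set gT}) (x : gT).

Definition num_quotients D x : nat :=
  #|[set d in setX D D | (d.1 * d.2^-1)%g == x]|.

(* Regularity (1 \notin D and D = D^-1) is part of the definition. *)
Definition PDS G D (v k lambda mu : nat) : Prop :=
  [/\ [/\ D \subset G, #|G| = v & #|D| = k],
      {in D, forall x, x != 1%g -> num_quotients D x = lambda},
      {in G :\: D, forall x, x != 1%g -> num_quotients D x = mu}
    & 1%g \notin D /\ D^-1%g = D].

Definition is_PDS G D : Prop := exists v k lambda mu, PDS G D v k lambda mu.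

Definition Cay (G : {group gT}) D : rel (subg_of G) :=
  fun g h => (sgval g * (sgval h)^-1)%g \in D.

End PartialDifferenceSets.

Arguments Cay {gT} G D g h : rename.

Definition graph_iso (T1 T2 : Type) (e1 : rel T1) (e2 : rel T2) : Prop :=
  exists2 f : T1 -> T2, bijective f & forall x y, e1 x y = e2 (f x) (f y).

Variant sign := Plus | Minus.

Section QuadraticForm.

Variables (F : finFieldType) (m : nat).
Implicit Types (x u w : 'rV[F]_(2 * m)).

(* Coordinates and basis vectors are indexed from 1 to 2m, while 'I_(2 * m)
   starts at 0; outside that range both are 0. *)
Definition co x (k : nat) : F := \sum_(j < 2 * m | j.+1 == k) x 0 j.

Definition e (k : nat) : 'rV[F]_(2 * m) := \row_j (j.+1 == k)%:R.

Definition Qform (eps : sign) (b : F) x : F :=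
  match eps with
  | Plus => \sum_(1 <= i < m.+1) co x (2 * i - 1) * co x (2 * i)
  | Minus => \sum_(1 <= i < m) co x (2 * i - 1) * co x (2 * i)
             + co x (2 * m - 1) ^+ 2 + b * co x (2 * m) ^+ 2
  end.

Definition is_square (a : F) : bool := [exists y : F, a == y ^+ 2].

Definition VO (eps : sign) (b : F) : rel 'rV[F]_(2 * m) :=
  fun u w => (u != w) && (Qform eps b (u - w) == 0).

Definition VNO (eps : sign) (b : F) : rel 'rV[F]_(2 * m) :=
  fun u w => [&& u != w, Qform eps b (u - w) != 0
               & is_square (Qform eps b (u - w))].

End QuadraticForm.

Arguments VO {F} m eps b u w : rename.
Arguments VNO {F} m eps b u w : rename.

Section AffineGroup.

Variables (F : finFieldType) (n : nat).

(* [M, u] is represented by the pair (M, u) with M invertible. *)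
Record agl := Agl {
  agl_val : 'M[F]_n * 'rV[F]_n;
  agl_unit : agl_val.1 \in unitmx }.

HB.instance Definition _ := [isSub for agl_val].
HB.instance Definition _ := [Finite of agl by <:].

Fact agl_mul_subproof (g h : agl) : (val g).1 *m (val h).1 \in unitmx.
Proof. by rewrite unitmx_mul !agl_unit. Qed.

Fact agl_inv_subproof (g : agl) : invmx (val g).1 \in unitmx.
Proof. by rewrite unitmx_inv agl_unit. Qed.

Definition agl_mul (g h : agl) : agl :=
  @Agl ((val g).1 *m (val h).1, (val g).2 *m (val h).1 + (val h).2)
       (agl_mul_subproof g h).

Definition agl_one : agl := @Agl (1%:M, 0) (unitmx1 F n).

Definition agl_inv (g : agl) : agl :=
  @Agl (invmx (val g).1, - ((val g).2 *m invmx (val g).1)) (agl_inv_subproof g).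

Fact agl_mulA : associative agl_mul.
Proof.
by move=> g h k; apply: val_inj; rewrite /= !mulmxA mulmxDl addrA.
Qed.

Fact agl_mul1 : left_id agl_one agl_mul.
Proof.
by move=> g; apply: val_inj; rewrite /= mul1mx mul0mx add0r; case: (agl_val g).
Qed.

Fact agl_mulV : left_inverse agl_one agl_inv agl_mul.
Proof.
move=> g; apply: val_inj; have Ug := agl_unit g.
by rewrite /= mulVmx // mulNmx mulmxKV // addNr.
Qed.

HB.instance Definition _ :=
  Finite_isGroup.Build agl agl_mulA agl_mul1 agl_mulV.

Definition translation (u : 'rV[F]_n) : agl := @Agl (1%:M, u) (unitmx1 F n).

Definition T_ (U : {vspace 'rV[F]_n}) : {set agl} :=
  [set translation u | u in U].

End AffineGroup.

Section TheGroupG2.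

Variables (F : finFieldType) (m : nat).
Implicit Types (alpha beta : F).

Definition B_mx alpha : 'M[F]_4 :=
  \matrix_(i, j) nth 0 (nth [::]
    [:: [:: 1;     0; 0;       0];
        [:: 0;     1; - alpha; 0];
        [:: 0;     0; 1;       0];
        [:: alpha; 0; 0;       1]] i) j.

(* Block-diagonal matrix diag (B_mx alpha, I), for m >= 2; when m < 2 this is
   the truncation of B_mx alpha. *)
Definition A_mx alpha : 'M[F]_(2 * m) :=
  \matrix_(i, j) if (i < 4)%N && (j < 4)%N
                 then B_mx alpha (inord i) (inord j) else (i == j)%:R.

Fact A_mx_unit alpha : A_mx alpha \in unitmx.
Proof.
pose N : 'M[F]_(2 * m) := (e F m 4)^T *m e F m 1 - (e F m 2)^T *m e F m 3.
have AE a : A_mx a = 1%:M + a *: N.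
  apply/matrixP=> i j; rewrite !mxE !big_ord1 !mxE -val_eqE /=.
  case: ifPn => [/andP[i4 j4] | nij4].
    rewrite !inordK //.
    case: i i4 => [[|[|[|[|i]]]] ltin] //= _;
    case: j j4 => [[|[|[|[|j]]]] ltjn] //= _;
    by rewrite ?(mulr0, mul0r, mulr1, subr0, sub0r, add0r, addr0, mulrN, oppr0).
  case: i nij4 => [[|[|[|[|i]]]] ltin];
  case: j => [[|[|[|[|j]]]] ltjn] //= _;
  by rewrite ?(mulr0, mul0r, mulr1, subr0, sub0r, add0r, addr0, mulrN, oppr0).
have ee k l : k != l -> e F m k *m (e F m l)^T = 0.
  move=> nkl; apply/matrixP=> i j; rewrite !mxE big1 // => s _; rewrite !mxE.
  case: eqP => [-> | _]; last by rewrite mul0r.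
  by rewrite (negPf nkl) mulr0.
have N0 : N *m N = 0.
  rewrite /N mulmxBr !mulmxBl !mulmxA.
  have ne k l s t : l != s ->
      (e F m k)^T *m e F m l *m (e F m s)^T *m e F m t = 0.
    by move=> nls; rewrite -[_ *m _ *m (e F m s)^T]mulmxA ee // mulmx0 mul0mx.
  by rewrite !ne // !subr0.
have /mulmx1_unit[] // : A_mx alpha *m A_mx (- alpha) = 1%:M.
rewrite !AE mulmxDr !mulmxDl !(mul1mx, mulmx1) -scalemxAl -!scalemxAr N0.
by rewrite !scaler0 addr0 scaleNr addrK.
Qed.

Definition b_elt alpha beta : agl F (2 * m) :=
  @Agl F (2 * m) (A_mx alpha, alpha *: e F m 2 + beta *: e F m 3)
       (A_mx_unit alpha).

Definition Bgrp : {group agl F (2 * m)} :=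
  <<[set b_elt alpha beta | alpha : F, beta : F]>>%G.

Definition Uspace : {vspace 'rV[F]_(2 * m)} :=
  <<[seq e F m i | i <- iota 1 (2 * m) & (i \notin [:: 2; 3])%N]>>%VS.

Definition G2 : {group agl F (2 * m)} := <<T_ Uspace :|: Bgrp>>%G.

End TheGroupG2.

(* Main.v *)
Require Import Defs.
From mathcomp Require Import all_boot all_order all_algebra all_fingroup.
From mathcomp Require Import finfield ring zify.

(** Write [A_alpha] for the matrices defining the group.  Its elements are
    exactly the affine maps with linear part [A_(v_2)] and translation part [v],
    one for each vector [v]; so the group acts regularly on the vector space, and
    it acts by isometries of [Q], since each [A_alpha] preserves [Q].  Sending an
    element to its translation part (the image of the zero vector) therefore
    turns [g h^-1] into [v - w] up to an isometry.  For a set [P] of scalars let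
    [diffset P] be the set of nonidentity elements whose translation part has its
    [Q]-value in [P]; its Cayley graph is the graph on the vector space in which
    distinct [v], [w] are adjacent when [Q (v - w)] is in [P].  Taking for [P] the
    singleton 0, the nonsquares and the nonzero squares gives the three sets.
    The last two graphs are exchanged by a linear similitude of [Q] whose
    multiplier is a nonsquare.

    What remains is strong regularity: for [v != 0], the number of [w] with [Q w]
    and [Q (v - w)] in [P] must depend only on whether [Q v] is in [P].
    - Fix a hyperbolic pair [e], [f] and let [n(s)] be the number of [x]
      orthogonal to both with [Q x = s].  Similitudes show that [n] is constant
      on nonzero scalars ([level_const]).
    - After applying a reflection, [v] is not orthogonal to [e].  Splitting
      [w = y v + z e + x] with [x] orthogonal to [e] and [f], and eliminating
      [z], shows that the number of [w] with [Q w = a] and [Q (v - w) = a'] is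
      the sum over [y] of [n(a (1 - y) + a' y - Q(v) y (1 - y))] ([fibre_sum]).
    - Hence the count depends only on the number of triples [(a, a', y)] with
      [a], [a'] in [P] and [a (1 - y) + a' y = c y (1 - y)], where [c = Q v]
      ([card_quad_pairs]).  Multiplying by scalars reduces this to comparing
      [c = 0] with [c] a nonsquare for [P] the nonzero squares.  If there are [s]
      of these, both numbers of triples are [s (s - 1)] ([card_splittings0],
      [card_splittings_nonsquare]). *)

Set Implicit Arguments.
Unset Strict Implicit.
Unset Printing Implicit Defensive.

Import GRing.Theory.
Local Open Scope ring_scope.

(** * Squares in a finite field of odd characteristic *)

Section Squares.

Variable F : finFieldType.
Implicit Types (a b c r u y : F).

Definition nzsquares : {set F} := [set a | (a != 0) && is_square a].
Definition nonsquares : {set F} := [set a | ~~ is_square a].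

Lemma is_squareP a : reflect (exists y, a = y ^+ 2) (is_square a).
Proof. by apply: (iffP existsP) => -[y Ey]; exists y; apply/eqP. Qed.

Lemma is_square_sqr a : is_square (a ^+ 2).
Proof. by apply/is_squareP; exists a. Qed.

Lemma is_square0 : is_square (0 : F).
Proof. by apply/is_squareP; exists 0; rewrite expr0n. Qed.

Lemma is_square1 : is_square (1 : F).
Proof. by apply/is_squareP; exists 1; rewrite expr1n. Qed.

Lemma nonsquare_neq0 a : ~~ is_square a -> a != 0.
Proof. by apply: contraNneq => ->; apply: is_square0. Qed.

Lemma is_squareMsqr a b : b != 0 -> is_square (a * b ^+ 2) = is_square a.
Proof.
move=> b0; apply/is_squareP/is_squareP=> [] [y Ey].
  exists (y / b); rewrite exprMn -Ey exprVn mulfK //.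
  by rewrite expf_eq0.
by exists (y * b); rewrite Ey exprMn.
Qed.

Hypothesis two_neq0 : (2%:R : F) != 0.

Lemma card_sqrt a : a \in nzsquares -> #|[set y | y ^+ 2 == a]| = 2%N.
Proof.
rewrite inE => /andP[a0 /is_squareP[y Ey]].
have y0 : y != 0 by apply: contraNneq a0 => y0; rewrite Ey y0 expr0n.
have -> : [set z | z ^+ 2 == a] = [set y; - y].
  by apply/setP=> z; rewrite !inE Ey eqf_sqr.
rewrite cards2 -addr_eq0 -mulr2n -mulr_natl mulf_eq0 negb_or y0.
by rewrite two_neq0.
Qed.

Lemma card_nzsquares : (#|nzsquares| * 2).+1 = #|F|.
Proof.
rewrite -[RHS]cardsT (cardsD1 0 [set: F]) inE add1n; congr _.+1.
rewrite -!sum1_card big_distrl /=.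
rewrite [RHS](partition_big (fun y => y ^+ 2) (mem nzsquares)) /=; last first.
  by move=> y; rewrite !inE is_square_sqr expf_eq0 /= ?andbT.
apply: eq_bigr => a Sa; rewrite mul1n -[LHS](card_sqrt Sa) -sum1_card.
apply: eq_bigl => y; rewrite !inE; case: eqP => [Ey|_]; rewrite ?(andbT, andbF) //.
by move: Sa; rewrite inE -Ey expf_eq0 /= => /andP[->].
Qed.

Lemma card_nonsquares : #|nonsquares| = #|nzsquares|.
Proof.
have: (#|nzsquares| + #|nonsquares|).+1 = #|F|.
  rewrite -[RHS]cardsT (cardsD1 0 [set: F]) inE add1n; congr _.+1.
  rewrite -cardsUI -[RHS]addn0; congr (_ + _)%N; last first.
    apply/eqP; rewrite cards_eq0 -subset0; apply/subsetP=> a.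
    by rewrite !inE -andbA andbN andbF.
  apply: eq_card => a; rewrite !inE ?andbT.
  by case: eqP => [->|]; rewrite /= ?is_square0 // orbN.
by rewrite -card_nzsquares; lia.
Qed.

(** Multiplication by a fixed nonsquare injects the nonzero squares into the
    nonsquares, and the two sets have the same size. *)
Lemma is_squareM a b : a != 0 -> b != 0 ->
  is_square (a * b) = (is_square a == is_square b).
Proof.
have sqM x y : x != 0 -> is_square y -> y != 0 -> is_square (x * y) = is_square x.
  move=> x0 /is_squareP[z ->] /=; rewrite expf_eq0 /= => z0.
  exact: is_squareMsqr.
move=> a0 b0; have [sb|nb] := boolP (is_square b); first by rewrite sqM // eqb_id.
have [sa|na] := boolP (is_square a); first by rewrite mulrC sqM // (negPf nb).
have inj_a : injective ( *%R a) by apply: mulfI.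
have sub : [set a * x | x in nzsquares] \subset nonsquares.
  by apply/subsetP=> _ /imsetP[x /[!inE] /andP[x0 sx] ->]; rewrite sqM.
have /eqP img : [set a * x | x in nzsquares] == nonsquares.
  by rewrite eqEcard sub card_imset // card_nonsquares /=.
have: b \in nonsquares by rewrite inE.
rewrite -img => /imsetP[x /[!inE] /andP[x0 sx] ->].
by rewrite mulrA -expr2 mulrC is_squareMsqr.
Qed.

Lemma is_squareV a : is_square a^-1 = is_square a.
Proof.
have [->|a0] := eqVneq a 0; first by rewrite invr0.
by rewrite -[LHS](is_squareMsqr _ a0) expr2 mulKf.
Qed.

Lemma exists_nonsquare : exists c : F, ~~ is_square c.
Proof.
have: (0 < #|nonsquares|)%N.
  rewrite card_nonsquares; apply/card_gt0P; exists 1.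
  by rewrite inE oner_eq0 is_square1.
by case/card_gt0P=> c /[!inE]; exists c.
Qed.

(** If every value of the binary form were a square, then so would be [b] (take
    [s = 0]), hence every [s ^+ 2 + 1], hence by induction every multiple of 1,
    in particular -1; but then [- b] would be a square. *)
Lemma nonsquare_norm b : ~~ is_square (- b) ->
  exists s t : F, ~~ is_square (s ^+ 2 + b * t ^+ 2).
Proof.
move=> nb; have [/is_squareP[d Ed]|nsb] := boolP (is_square b); last first.
  by exists 0, 1; rewrite expr0n expr1n mulr1 add0r.
have d0 : d != 0.
  by apply: contraNneq nb => d0; rewrite Ed d0 expr0n oppr0 is_square0.
suff: [exists s : F, ~~ is_square (s ^+ 2 + 1)].
  by case/existsP=> s ns; exists s, d^-1; rewrite Ed exprVn divff ?expf_neq0.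
apply: contraR nb => /existsPn sqD1.
have sq_nat n : is_square (n%:R : F).
  elim: n => [|n /is_squareP[s Es]]; first exact: is_square0.
  by rewrite -natr1 Es -[is_square _]negbK sqD1.
have [p p_pr charFp] := finPcharP F.
have -> : - b = p.-1%:R * d ^+ 2.
  apply/eqP; rewrite Ed eq_sym -addr_eq0 -{2}[d ^+ 2]mul1r -mulrDl natr1.
  by rewrite prednK ?prime_gt0 // (pcharf0 charFp) mul0r.
by rewrite is_squareMsqr // sq_nat.
Qed.

(** For [y] different from 0 and 1 the equation reads
    [c = a / y + b / (1 - y)]; this is the form in which [c] is the value of [Q]
    at a vector, and [a], [b] are its values at the two parts of that vector. *)
Definition splittings (P : {set F}) c : {set F * F * F} :=
  [set t | [&& t.1.1 \in P, t.1.2 \in P &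
    t.1.1 * (1 - t.2) + t.1.2 * t.2 == c * t.2 * (1 - t.2)]].

Lemma card_splittings_scale (P P' : {set F}) u c : u != 0 ->
  (forall a, (u * a \in P') = (a \in P)) ->
  #|splittings P' (u * c)| = #|splittings P c|.
Proof.
move=> u0 uP; pose f (t : F * F * F) := (u * t.1.1, u * t.1.2, t.2).
have f_inj : injective f.
  by move=> [[a b] y] [[a' b'] y'] [] /(mulfI u0)-> /(mulfI u0)-> ->.
rewrite -(card_preimset _ f_inj); apply: eq_card => -[[a b] y].
rewrite !inE /= !uP -!mulrA -mulrDr (inj_eq (mulfI u0)).
by rewrite !mulrA.
Qed.

(** For [c = 0] the equation is linear in [y]: it has the root [a / (a - b)] when
    [a != b], and none when [a = b]. *)
Lemma card_splittings0 (P : {set F}) : 0 \notin P ->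
  #|splittings P 0| = (#|P| * #|P|.-1)%N.
Proof.
move=> P0; pose f (p : F * F) := (p.1, p.2, p.1 / (p.1 - p.2)).
pose X := [set p : F * F | [&& p.1 \in P, p.2 \in P & p.1 != p.2]].
have f_inj : injective f by move=> [a b] [a' b'] [] -> ->.
have -> : splittings P 0 = f @: X.
  apply/setP=> -[[a b] y]; rewrite inE /= !mul0r.
  apply/and3P/imsetP=> [[Pa Pb /eqP E]|[[a' b'] /[!inE] /= /and3P[Pa Pb nab]]].
    have Ea : a = (a - b) * y by apply/eqP; rewrite -subr_eq0 -E; apply/eqP; ring.
    have nab : a != b.
      by apply: contraNneq P0 => Eab; move: Pa; rewrite Ea Eab subrr mul0r.
    exists (a, b); first by rewrite inE Pa Pb.
    by congr (_, _, _); rewrite /= {1}Ea mulrC mulKf // subr_eq0.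
  case=> -> -> ->; split=> //; apply/eqP; field.
  by rewrite subr_eq0.
rewrite card_imset //.
have -> : X = [set p in setX P P | p.1 != p.2].
  by apply/setP=> -[a b]; rewrite !inE andbA.
rewrite -sum1_card.
rewrite (eq_bigl (fun p : F * F =>
    (p.1 \in P) && ((p.2 \in P) && (p.1 != p.2)))); last first.
  by move=> p; rewrite !inE -andbA.
rewrite -(pair_big_dep (mem P) (fun a b => (b \in P) && (a != b)) (fun _ _ => 1%N)).
rewrite /= -sum_nat_const; apply: eq_bigr => a Pa.
rewrite sum1_card (cardsD1 a P) Pa; apply: eq_card => b.
by rewrite !inE andbC eq_sym.
Qed.

(** The values 0 and 1 are excluded, so that both [y] and [1 - y] have a
    quadratic character. *)
Definition square_classes (i j : bool) : {set F} :=
  [set y | [&& y != 0, y != 1, is_square y == i & is_square (1 - y) == j]].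

Local Notation A := square_classes.

Lemma onem_neq0 y : (1 - y != 0) = (y != 1).
Proof. by rewrite subr_eq0 eq_sym. Qed.

Lemma in_square_classes i j y :
  (y \in A i j) = [&& y != 0, y != 1, is_square y == i & is_square (1 - y) == j].
Proof. by rewrite inE. Qed.

Lemma card_square_classes_sym i j : #|A i j| = #|A j i|.
Proof.
have inv : involutive (fun y => 1 - y) by move=> y; rewrite subKr.
rewrite -(card_preimset _ (inv_inj inv)); apply: eq_card => y.
rewrite !inE subKr -!onem_neq0 subKr.
by case: (y != 0); case: (1 - y != 0); rewrite //= andbC.
Qed.

Lemma card_square_classes_pair (i : bool) :
  (#|A i true| + #|A i false|)%N = (#|nzsquares| - i)%N.
Proof.
rewrite -cardsUI; have -> : A i true :&: A i false = set0.
  apply/setP=> y; rewrite !inE; case: (is_square (1 - y)); rewrite ?andbF //.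
rewrite cards0 addn0; case: i => /=.
  rewrite (cardsD1 1 nzsquares) inE oner_eq0 is_square1 add1n subn1 /=.
  apply: eq_card => y; rewrite !inE; case: (is_square (1 - y));
  by rewrite ?(andbT, andbF) ?eqb_id ?orbF //= andbCA.
rewrite subn0 -card_nonsquares; apply: eq_card => y; rewrite !inE.
case: (boolP (is_square y)); rewrite ?andbF //= => ny.
rewrite (nonsquare_neq0 ny) (contraNneq _ ny) /=; last by move->; apply: is_square1.
by case: (is_square (1 - y)).
Qed.

(** Away from 0 and 1 the map [y |-> y^-1 - 1 = (1 - y) / y] is injective and its
    values are all scalars other than 0 and -1; such a value is a nonsquare
    exactly when [y] and [1 - y] have different quadratic characters. *)
Lemma card_square_classes_neq :
  (#|A true false| * 2 + ~~ is_square (- 1 : F)%R)%N = #|nzsquares|.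
Proof.
rewrite muln2 -addnn {2}card_square_classes_sym -card_nonsquares.
rewrite (cardsD1 (- 1) nonsquares) inE addnC; congr (_ + _)%N.
rewrite -cardsUI; have -> : A true false :&: A false true = set0.
  apply/setP=> y; rewrite !inE; case: (is_square y); rewrite ?andbF //.
rewrite cards0 addn0.
have f_inj : injective (fun y : F => y^-1 - 1).
  by move=> y z /addIr /invr_inj.
rewrite -(card_imset _ f_inj); apply: eq_card => u; rewrite !inE.
apply/imsetP/andP=> [[y] | [u1 nu]].
  move=> Ay; have [y0 y1 Ey] : [/\ y != 0, y != 1 & is_square y != is_square (1 - y)].
    move: Ay; rewrite !inE; case: (y == 0) => //; case: (y == 1) => //.
    by case: (is_square y); case: (is_square (1 - y)).
  have Eu : y^-1 - 1 = (1 - y) * y^-1 by field.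
  move->; split; first by rewrite -subr_eq0 opprK subrK invr_eq0.
  by rewrite Eu is_squareM ?invr_neq0 ?onem_neq0 // is_squareV eq_sym.
have u0 := nonsquare_neq0 nu.
have u10 : u + 1 != 0 by rewrite addr_eq0.
exists (u + 1)^-1; last by rewrite invrK addrK.
have E : 1 - (u + 1)^-1 = u * (u + 1)^-1 by field.
have v0 : (u + 1)^-1 != 0 by rewrite invr_eq0.
have v1 : (u + 1)^-1 != 1 by rewrite -onem_neq0 E mulf_neq0.
rewrite in_setU !in_square_classes E is_squareM // !is_squareV (negPf nu) v0 v1.
by case: (is_square (u + 1)).
Qed.

(** Put [a = c r y] and [b = c (1 - r) (1 - y)]: the triples become pairs [(r, y)]
    such that [r], [y] have opposite quadratic characters, and so do [1 - r],
    [1 - y].  Their number is the sum over the four classes of the size of a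
    class times that of the opposite class.  With [s] nonzero squares, let [x] be
    the size of the two mixed classes; the others have sizes [s - 1 - x] and
    [s - x], and [s] is [2 x] or [2 x + 1], so that the sum
    [2 ((s - 1 - x) (s - x) + x ^ 2)] is [s (s - 1)] in both cases. *)
Lemma card_splittings_nonsquare c : ~~ is_square c ->
  #|splittings nzsquares c| = (#|nzsquares| * #|nzsquares|.-1)%N.
Proof.
move=> nc; have c0 := nonsquare_neq0 nc.
pose X := [set p : F * F | [&& p.2 != 0, p.2 != 1 &
  p.1 \in A (~~ is_square p.2) (~~ is_square (1 - p.2))]].
pose f (p : F * F) := (c * (p.1 * p.2), c * ((1 - p.1) * (1 - p.2)), p.2).
have f_inj : {in X &, injective f}.
  move=> [r y] [r' y'] /[!inE] /= /and3P[y0 _ _] _ [] /(mulfI c0) E _ Ey.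
  by move: E; rewrite -Ey => /(mulIf y0)->.
have -> : splittings nzsquares c = f @: X.
  apply/setP=> -[[a b] y]; rewrite !inE /=; apply/and3P/imsetP.
    case=> /andP[a0 sa] /andP[b0 sb] /eqP E.
    have y0 : y != 0.
      apply: contraNneq a0 => y0; move: E; rewrite y0 !mulr0 subr0 mulr1 mul0r addr0.
      by move->.
    have y1 : 1 - y != 0.
      apply: contraNneq b0 => y1; have Ey : y = 1 by rewrite -[LHS](subKr 1) y1 subr0.
      by move: E; rewrite y1 Ey !mulr0 mulr1 add0r => ->.
    have Er : 1 - a / (c * y) = b / (c * (1 - y)).
      apply: (mulfI c0); apply: (mulfI y0); apply: (mulfI y1).
      have -> : (1 - y) * (y * (c * (1 - a / (c * y))))
                = c * y * (1 - y) - a * (1 - y) by field; rewrite y0.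
      by rewrite -E [_ + b * y]addrC addrK; field; rewrite y1.
    exists (a / (c * y), y) => /=; last first.
      congr (_, _, _) => /=; first by field; rewrite y0.
      by rewrite Er; field; rewrite y1.
    rewrite !inE /= y0 -onem_neq0 y1 -[a / _ != 1]onem_neq0 Er.
    rewrite !mulf_eq0 !invr_eq0 !mulf_eq0 !negb_or a0 b0 c0 y0 y1 /=.
    rewrite !is_squareM ?is_squareV ?is_squareM ?invr_eq0 ?mulf_neq0 //.
    rewrite (negPf nc) sa sb.
    by case: (is_square y); case: (is_square (1 - y)).
  case=> -[r z] /[!inE] /= /and3P[z0 z1 /and4P[r0 r1 /eqP sr /eqP s1r]] [-> -> ->].
  move: r1 z1; rewrite -!onem_neq0 => r1 z1.
  rewrite !mulf_neq0 //=; split; last by apply/eqP; ring.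
    by rewrite !is_squareM ?mulf_neq0 // (negPf nc) sr; case: (is_square z).
  by rewrite !is_squareM ?mulf_neq0 // (negPf nc) s1r; case: (is_square (1 - z)).
rewrite card_in_imset //.
have -> : #|X| = (\sum_i \sum_j #|A i j| * #|A (~~ i) (~~ j)|)%N.
  rewrite -sum1_card.
  transitivity (\sum_(p in {: bool * bool}) #|A p.1 p.2| * #|A (~~ p.1) (~~ p.2)|)%N.
    rewrite (partition_big (fun p : F * F => (is_square p.2, is_square (1 - p.2)))
               predT) //=.
    apply: eq_bigr => -[i j] _ /=; rewrite mulnC -cardsX sum1_card.
    apply: eq_card => -[r y]; rewrite !inE /= unfold_in /= !inE /= xpair_eqE.
    case: (y != 0) => /=; last by rewrite andbF.
    case: (y != 1) => /=; last by rewrite andbF.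
    apply/andP/andP => -[].
      by move=> E /andP[/eqP <- /eqP <-]; rewrite !eqxx; case/and4P: E => -> -> -> ->.
    by move=> E /andP[/eqP Ei /eqP Ej]; rewrite Ei Ej !eqxx.
  by rewrite pair_big.
rewrite !big_bool /= (card_square_classes_sym false true).
have := card_square_classes_pair true; have := card_square_classes_pair false.
have := card_square_classes_neq.
have s0 : (0 < #|nzsquares|)%N.
  by apply/card_gt0P; exists 1; rewrite inE oner_eq0 is_square1.
rewrite (card_square_classes_sym false true).
move: s0 #|A true true| #|A true false| #|A false false| (~~ is_square (-1 : F)).
move: #|nzsquares| => s s0 x y z n E1 E2 E3.
have Ez : z = (s - y)%N by lia.
have Ex : x = (s.-1 - y)%N by lia.
(* [n] tells whether -1 is a nonsquare, which is the parity of [s]. *)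
rewrite {}Ez {}Ex; case: n E1 => /= E1.
  have -> : s = (2 * y).+1 by lia.
  have -> : ((2 * y).+1 - y)%N = y.+1 by lia.
  have -> : ((2 * y).+1.-1 - y)%N = y by lia.
  by rewrite /=; nia.
have {E1}Es : s = (2 * y)%N by lia.
case: y Es E2 E3 => [|y] Es E2 E3; first by lia.
rewrite {}Es; have -> : (2 * y.+1 - y.+1)%N = y.+1 by lia.
have -> : ((2 * y.+1).-1 - y.+1)%N = y by lia.
have -> : ((2 * y.+1).-1)%N = (2 * y).+1 by lia.
nia.
Qed.

(** The arithmetic condition under which the difference set attached to [P] is
    a partial difference set. *)
Definition splitting_regular (P : {set F}) : Prop := exists n1 n2,
  {in P, forall a, #|splittings P a| = n1} /\
  (forall a, a \notin P -> #|splittings P a| = n2).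

Lemma splitting_regular_zero : splitting_regular [set 0].
Proof.
exists #|splittings [set 0] 0|, #|splittings [set 0] 1|; split=> a.
  by rewrite inE => /eqP->.
rewrite inE => a0; rewrite -[a in LHS]mulr1; apply: card_splittings_scale => // x.
by rewrite !inE mulf_eq0 (negPf a0).
Qed.

Lemma splitting_regular_nzsquares : splitting_regular nzsquares.
Proof.
exists #|splittings nzsquares 1|, (#|nzsquares| * #|nzsquares|.-1)%N; split=> a.
  rewrite inE => /andP[a0 sa]; rewrite -[a in LHS]mulr1.
  apply: card_splittings_scale => // x; rewrite !inE mulf_eq0 (negPf a0) /=.
  by have [//|x0] := eqVneq x 0; rewrite is_squareM // sa; case: (is_square x).
rewrite inE negb_and negbK => /orP[/eqP->|]; last exact: card_splittings_nonsquare.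
by rewrite card_splittings0 // inE eqxx.
Qed.

Lemma splitting_regular_nonsquares : splitting_regular nonsquares.
Proof.
have scaleN u c : ~~ is_square u ->
    #|splittings nonsquares (u * c)| = #|splittings nzsquares c|.
  move=> nu; have u0 := nonsquare_neq0 nu; apply: card_splittings_scale => // x.
  rewrite !inE; have [->|x0] := eqVneq x 0; first by rewrite mulr0 is_square0.
  by rewrite is_squareM // (negPf nu); case: (is_square x).
exists #|splittings nzsquares 1|, (#|nzsquares| * #|nzsquares|.-1)%N; split=> a.
  by rewrite inE => na; rewrite -[a in LHS]mulr1 scaleN.
rewrite inE negbK => sa; have [u nu] := exists_nonsquare.
have u0 := nonsquare_neq0 nu; rewrite -[a](mulVKf u0) scaleN //.
have [->|a0] := eqVneq a 0; first by rewrite mulr0 card_splittings0 // inE eqxx.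
apply: card_splittings_nonsquare.
by rewrite is_squareM ?invr_neq0 // is_squareV (negPf nu) sa.
Qed.

End Squares.

(** * Counting vectors in a quadratic space *)

Section QuadraticSpace.

Variables (F : finFieldType) (V : finLmodType F).
Variables (Q : V -> F) (B : V -> V -> F).
Implicit Types (a b c s t y : F) (u v w x : V) (P : {set F}).

Hypothesis QZ : forall a x, Q (a *: x) = a ^+ 2 * Q x.
Hypothesis QD : forall x w, Q (x + w) = Q x + Q w + B x w.
Hypothesis BD : forall x w u, B (x + w) u = B x u + B w u.
Hypothesis BZ : forall a x u, B (a *: x) u = a * B x u.

Lemma polarC x w : B x w = B w x.
Proof. by apply: (addrI (Q x + Q w)); rewrite -QD addrC QD [Q w + _]addrC. Qed.

Lemma polarDr u x w : B u (x + w) = B u x + B u w.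
Proof. by rewrite !(polarC u) BD. Qed.

Lemma polarZr a u x : B u (a *: x) = a * B u x.
Proof. by rewrite !(polarC u) BZ. Qed.

Lemma polarN x w : B (- x) w = - B x w.
Proof. by rewrite -scaleN1r BZ mulN1r. Qed.

Lemma polarNr x w : B x (- w) = - B x w.
Proof. by rewrite -scaleN1r polarZr mulN1r. Qed.

Lemma polar_diag x : B x x = 2%:R * Q x.
Proof.
apply: (addrI (Q x + Q x)); rewrite -QD -mulr2n -scaler_nat QZ.
ring.
Qed.

Lemma quadN x : Q (- x) = Q x.
Proof. by rewrite -scaleN1r QZ sqrrN expr1n mul1r. Qed.

Lemma quad0 : Q 0 = 0.
Proof. by rewrite -(scale0r 0) QZ expr0n mul0r. Qed.

Let polarE := (BD, BZ, polarDr, polarZr, polarN, polarNr).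

Definition reflection u x := x - (B x u / Q u) *: u.

Lemma quad_reflection u x : Q u != 0 -> Q (reflection u x) = Q x.
Proof. by move=> u0; rewrite /reflection QD quadN QZ !polarE; field. Qed.

Lemma polar_reflection u x w : Q u != 0 ->
  B (reflection u x) (reflection u w) = B x w.
Proof.
move=> u0; rewrite /reflection !polarE polar_diag (polarC u w).
by field.
Qed.

Lemma reflectionK u : Q u != 0 -> involutive (reflection u).
Proof.
move=> u0 x; rewrite /reflection !polarE polar_diag.
rewrite -addrA -opprD -scalerDl.
rewrite [X in X *: u](_ : _ = 0) ?scale0r ?subr0 //.
by field.
Qed.

Hypothesis nondegenerate : forall v, v != 0 -> exists u, B v u != 0.

(** A vector in the kernel of [sigma] would be orthogonal to everything. *)
Lemma similitude_inj c (sigma : V -> V) : c != 0 ->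
  {morph sigma : x w / x + w} -> (forall x, Q (sigma x) = c * Q x) ->
  injective sigma.
Proof.
move=> c0 sigmaD Qsigma.
have Bsigma x w : B (sigma x) (sigma w) = c * B x w.
  apply: (addrI (Q (sigma x) + Q (sigma w))).
  by rewrite -QD -sigmaD !Qsigma QD !mulrDr.
have sigma0 : sigma 0 = 0 by apply: (addIr (sigma 0)); rewrite -sigmaD !add0r.
have sigma_ker x : sigma x = 0 -> x = 0.
  move=> sx0; apply/eqP; apply: contraT => /nondegenerate[u].
  by rewrite -(inj_eq (mulfI c0)) mulr0 -Bsigma sx0 -(scale0r 0) BZ mul0r eqxx.
move=> x w E; apply/subr0_eq/sigma_ker.
by apply: (addIr (sigma w)); rewrite -sigmaD subrK add0r.
Qed.

Variables e f : V.
Hypotheses (Qe : Q e = 0) (Bef : B e f = 1).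

Lemma polar_ee : B e e = 0. Proof. by rewrite polar_diag Qe mulr0. Qed.

(** Choose [u] with [B v u != 0] and [B e u = 1]; as [v] and [e] are orthogonal to
    [e], adding a multiple of [e] keeps both and makes [Q u = 1].  The reflection
    in [u] then changes [B v e] by a nonzero amount. *)
Lemma reflection_off_hyperplane v : v != 0 -> B v e = 0 ->
  exists2 u, Q u = 1 & B (reflection u v) e != 0.
Proof.
move=> v0 Bve.
have [u Bvu Beu] : exists2 u, B v u != 0 & B e u = 1.
  have [Bvf|Bvf] := eqVneq (B v f) 0; last by exists f.
  have [u Bvu] := nondegenerate v0; exists (u + (1 - B e u) *: f).
    by rewrite !polarE Bvf mulr0 addr0.
  by rewrite !polarE Bef; ring.
have Qu : Q (u + (1 - Q u) *: e) = 1.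
  by rewrite QD QZ Qe polarE polarC Beu; ring.
exists (u + (1 - Q u) *: e) => //.
rewrite /reflection Qu !polarE Bve polar_ee (polarC u e) Beu.
by rewrite !mulr0 !addr0 divr1 mulr1 sub0r oppr_eq0.
Qed.

Definition level s : nat :=
  #|[set x | [&& B x e == 0, B x f == 0 & Q x == s]]|.

Definition fibre v a t : nat := #|[set w | (Q w == a) && (B w v == t)]|.

Lemma fibre_reflection u v a t : Q u != 0 ->
  fibre (reflection u v) a t = fibre v a t.
Proof.
move=> u0; rewrite /fibre -(card_preimset _ (inv_inj (reflectionK u0))).
by apply: eq_card => w; rewrite !inE quad_reflection // polar_reflection.
Qed.

(** The vectors with [B w e = y * B v e] are [w = y v + z e + x] with [x]
    orthogonal to [e]; here [x] is normalized to be orthogonal to [f] as well.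
    The condition [B w v = t] determines [z], and substituting it makes [Q w]
    equal to [t y - Q(v) y ^ 2 + Q x]. *)
Lemma fibre_sum v a t : B v e != 0 ->
  fibre v a t = (\sum_y level (a - t * y + Q v * y ^+ 2)%R)%N.
Proof.
move=> ve; rewrite /fibre -sum1_card.
rewrite (partition_big (fun w => B w e / B v e) predT) //=.
apply: eq_bigr => y _.
(* The coefficient [z x] of [e] is forced by [B w v = t]. *)
pose z x := (t - y * (2%:R * Q v) - B x v) / B v e.
pose h x := y *: v + z x *: e + x.
pose h' w := let x := w - y *: v in x - B x f *: e.
rewrite (reindex_onto h h') /=; last first.
  move=> w; rewrite inE => /andP[/andP[_ /eqP Bwv] /eqP Bwe].
  have Ewe : B w e = y * B v e by rewrite -Bwe divfK.
  rewrite /h /h'; set x := w - y *: v.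
  have Ez : z (x - B x f *: e) = B x f.
    rewrite /z /x !polarE polar_diag Bwv (polarC e v).
    by field.
  rewrite Ez [_ + (x - _)]addrC addrACA [- _ + _]addNr addr0 [x + _]addrC /x.
  by rewrite addrC subrK.
rewrite sum1_card; apply: eq_card => x; rewrite !inE /=.
have Bhe : B (h x) e = y * B v e + B x e.
  by rewrite /h !polarE polar_ee mulr0 addr0.
have Bhv : B (h x) v = t.
  rewrite /h !polarE polar_diag (polarC e v) /z; by field.
have Qh : Q (h x) = t * y - Q v * y ^+ 2 + Q x + z x * B e x.
  rewrite /h !QD !QZ Qe !polarE /z (polarC v x).
  by field.
have h'h : h' (h x) = x - B x f *: e.
  have Ex : h x - y *: v = z x *: e + x.
    by rewrite /h -[_ + _ + x]addrA [LHS]addrC addKr.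
  by rewrite /h' /= Ex !polarE Bef mulr1 scalerDl opprD addrACA subrr add0r.
have He : (B (h x) e / B v e == y) = (B x e == 0).
  rewrite Bhe mulrDl mulfK // -subr_eq0 addrC addKr mulf_eq0 invr_eq0.
  by rewrite (negPf ve) orbF.
have Hf : (h' (h x) == x) = (B x f == 0).
  rewrite h'h -subr_eq0 addrC addKr oppr_eq0 scaler_eq0.
  have -> : (e == 0) = false; last by rewrite orbF.
  by apply: contraNF ve => /eqP->; rewrite polarC -(scale0r 0) BZ mul0r.
rewrite unfold_in /= !inE He Hf Bhv eqxx andbT -andbA andbC -andbA.
have [Bxe|//] := eqVneq (B x e) 0.
rewrite !andTb Qh (polarC e x) Bxe mulr0 addr0; congr (_ && _).
rewrite -subr_eq0 -[in RHS]subr_eq0; congr (_ == 0); ring.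
Qed.

Variables (c : F) (sigma : V -> V).
Hypotheses (nonsquare_c : ~~ is_square c) (two_neq0 : (2%:R : F) != 0).
Hypotheses (sigma_inj : injective sigma)
  (quad_sigma : forall x, Q (sigma x) = c * Q x)
  (sigma_e : forall x, (B (sigma x) e == 0) = (B x e == 0))
  (sigma_f : forall x, (B (sigma x) f == 0) = (B x f == 0)).

(** Scalars multiply [Q] by squares, and [sigma] multiplies it by a nonsquare;
    both preserve the orthogonal of [e] and [f]. *)
Lemma level_const s : s != 0 -> level s = level 1.
Proof.
move=> s0; have c0 := nonsquare_neq0 nonsquare_c.
have levelM (g : V -> V) d r : injective g -> d != 0 ->
    (forall x, Q (g x) = d * Q x) -> (forall x, (B (g x) e == 0) = (B x e == 0)) ->
    (forall x, (B (g x) f == 0) = (B x f == 0)) -> level (d * r) = level r.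
  move=> g_inj d0 Qg ge gf; rewrite /level -(card_preimset _ g_inj).
  by apply: eq_card => x; rewrite !inE Qg ge gf (inj_eq (mulfI d0)).
have levelZ d r : d != 0 -> level (d ^+ 2 * r) = level r.
  move=> d0; apply: (levelM ( *:%R d)) => [x y||x|x|x].
  - by move/(scalerI d0).
  - by rewrite expf_eq0.
  - exact: QZ.
  - by rewrite BZ mulf_eq0 (negPf d0).
  - by rewrite BZ mulf_eq0 (negPf d0).
have sq_const r : r != 0 -> is_square r -> level r = level 1.
  move=> r0 /is_squareP[d Ed]; rewrite Ed -[d ^+ 2]mulr1 levelZ //.
  by apply: contraNneq r0 => d0; rewrite Ed d0 expr0n.
have [|ns] := boolP (is_square s); first exact: sq_const.
rewrite -(levelM sigma c) //; apply: sq_const; first by rewrite mulf_neq0.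
by rewrite is_squareM // (negPf nonsquare_c) (negPf ns).
Qed.

(** With [a = Q w] and [b = Q (v - w)] one has [B w v = Q v + a - b], so the set
    is a disjoint union of fibres; each is a sum of levels, and only the level of
    0 differs from the others. *)
Lemma card_quad_pairs P v : v != 0 ->
  #|[set w | (Q w \in P) && (Q (v - w) \in P)]| =
    (level 0%R * #|splittings P (Q v)|
     + level 1%R * (#|P| * #|P| * #|F| - #|splittings P (Q v)|))%N.
Proof.
move=> v0.
have fibreE a t : fibre v a t = (\sum_y level (a - t * y + Q v * y ^+ 2)%R)%N.
  have [Bve|] := eqVneq (B v e) 0; last exact: fibre_sum.
  have [u Qu Bre] := reflection_off_hyperplane v0 Bve.
  have u0 : Q u != 0 by rewrite Qu oner_eq0.
  by rewrite -(fibre_reflection _ _ _ u0) fibre_sum // quad_reflection.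
rewrite -sum1_card.
rewrite (partition_big (fun w => (Q w, Q (v - w))) (mem (setX P P))) /=; last first.
  by move=> w; rewrite !inE.
transitivity (\sum_(p in setX P P) \sum_y
   level (p.1 * (1 - y) + p.2 * y - Q v * y * (1 - y))%R)%N.
  apply: eq_bigr => -[a b] /[!inE] /= /andP[Pa Pb].
  transitivity (fibre v a (Q v + a - b)).
    rewrite sum1_card; apply: eq_card => w; rewrite unfold_in /= !inE xpair_eqE.
    rewrite QD quadN polarNr (polarC v w).
    case: (Q w =P a) => [->|]; rewrite ?andbF //= Pa /=.
    have -> : (B w v == Q v + a - b) = (Q v + a - B w v == b).
      rewrite -subr_eq0 -[in RHS]subr_eq0 -oppr_eq0; congr (_ == 0); ring.
    by case: eqP => [->|]; rewrite ?andbF // Pb.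
  rewrite fibreE; apply: eq_bigr => y _; congr level; ring.
rewrite pair_big /=.
set T := splittings P (Q v).
pose X := setX (setX P P) [set: F].
have sTX : T \subset X.
  by apply/subsetP=> -[[a b] y]; rewrite !inE /= => /and3P[-> ->].
have -> : (#|P| * #|P| * #|F| = #|X|)%N by rewrite !cardsX cardsT.
rewrite (eq_bigl (fun p => p \in X)); last by move=> -[[a b] y]; rewrite !inE.
rewrite (bigID (fun p => p \in T)) /=; congr (_ + _)%N.
  rewrite mulnC -sum_nat_const; apply: eq_big => [p|[[a b] y]] /=.
    by case: (boolP (p \in T)) => [/(subsetP sTX)->|]; rewrite ?andbF.
  by rewrite !inE /= => /andP[_ /and3P[_ _ /eqP->]]; rewrite subrr.
rewrite mulnC -cardsDS // -sum_nat_const; apply: eq_big => [p|[[a b] y]] /=.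
  by rewrite [in RHS]inE andbC.
rewrite !inE /= andbT => /andP[/andP[-> ->] /= nE].
by rewrite level_const // subr_eq0.
Qed.

End QuadraticSpace.

(** * The quadratic form in coordinates *)

Section Coordinates.

Variables (F : finFieldType) (m : nat).
Local Notation V := 'rV[F]_(2 * m).
Local Notation e := (e F m).
Implicit Types (x y : V) (a : F).

Lemma co_entry x (j : 'I_(2 * m)) : co x j.+1 = x 0 j.
Proof. by rewrite /co (big_pred1 j). Qed.

Lemma coD x y k : co (x + y) k = co x k + co y k.
Proof. by rewrite -big_split; apply: eq_bigr => j _; rewrite mxE. Qed.

Lemma coZ a x k : co (a *: x) k = a * co x k.
Proof. by rewrite big_distrr; apply: eq_bigr => j _; rewrite mxE. Qed.

Lemma co_row (g : nat -> F) k : (0 < k <= 2 * m)%N ->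
  co (\row_(j < 2 * m) g j.+1) k = g k.
Proof.
case: k => // k lt_k; have -> : k = Ordinal (lt_k : (k < 2 * m)%N) by [].
by rewrite co_entry mxE.
Qed.

Lemma co_e k l : (0 < k <= 2 * m)%N -> co (e l) k = (k == l)%:R.
Proof. exact: (co_row (fun k => (k == l)%:R)). Qed.

Lemma co_e_id k : (0 < k <= 2 * m)%N -> co (e k) k = 1.
Proof. by move=> k_bd; rewrite co_e // eqxx. Qed.

Lemma co_e_neq k l : (0 < k <= 2 * m)%N -> k != l -> co (e l) k = 0.
Proof. by move=> k_bd /negPf kl; rewrite co_e // kl. Qed.

Lemma mul_e_tr x k : x *m (e k)^T = (co x k)%:M.
Proof.
apply/matrixP=> i j; rewrite !ord1 !mxE /co [RHS]big_mkcond /=.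
by apply: eq_bigr => s _; rewrite !mxE; case: eqP; rewrite ?mulr1 ?mulr0.
Qed.

Lemma A_mxE alpha :
  A_mx m alpha = 1%:M + alpha *: ((e 4)^T *m e 1 - (e 2)^T *m e 3) :> 'M[F]_(2 * m).
Proof.
apply/matrixP=> i j; rewrite !mxE !big_ord1 !mxE -val_eqE /=.
case: ifPn => [/andP[i4 j4]|].
  rewrite !inordK //.
  case: i i4 => [[|[|[|[|i]]]] ?] //= _; case: j j4 => [[|[|[|[|j]]]] ?] //= _;
  by ring.
by case: i j => [[|[|[|[|i]]]] ?] [[|[|[|[|j]]]] ?] //= _; ring.
Qed.

Lemma mul_A_mx x alpha :
  x *m A_mx m alpha = x + alpha *: (co x 4 *: e 1 - co x 2 *: e 3).
Proof.
rewrite A_mxE mulmxDr mulmx1 -scalemxAr mulmxBr !mulmxA !mul_e_tr.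
by rewrite !mul_scalar_mx.
Qed.

End Coordinates.

Section TheForm.

Variables (F : finFieldType) (m : nat) (eps : sign) (b : F).
Local Notation V := 'rV[F]_(2 * m).
Local Notation e := (e F m).
Local Notation Q := (Qform eps b : V -> F).
Implicit Types (x y : V) (a c s t alpha : F).

Hypothesis m_ge2 : (2 <= m)%N.

(** The number of hyperbolic planes spanned by consecutive basis vectors; for
    [Minus] the last two coordinates carry an anisotropic form instead. *)
Definition planes : nat := if eps is Plus then m else m.-1.

Definition polar x y : F :=
  \sum_(1 <= i < planes.+1)
     (co x (2 * i - 1) * co y (2 * i) + co x (2 * i) * co y (2 * i - 1))
  + if eps is Plus then 0 else
      2%:R * (co x (2 * m - 1) * co y (2 * m - 1) + b * (co x (2 * m) * co y (2 * m))).

Lemma QformE x : Q x = \sum_(1 <= i < planes.+1) co x (2 * i - 1) * co x (2 * i)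
  + if eps is Plus then 0 else co x (2 * m - 1) ^+ 2 + b * co x (2 * m) ^+ 2.
Proof.
rewrite /Qform /planes; case: eps; first by rewrite addr0.
by rewrite prednK ?addrA //; lia.
Qed.

Lemma QformZ a x : Q (a *: x) = a ^+ 2 * Q x.
Proof.
rewrite !QformE mulrDr big_distrr /=; congr (_ + _).
  by apply: eq_bigr => i _; rewrite !coZ; ring.
by case: eps; rewrite ?mulr0 // !coZ; ring.
Qed.

Lemma QformD x y : Q (x + y) = Q x + Q y + polar x y.
Proof.
rewrite !QformE /polar [X in _ = X + _]addrACA [RHS]addrACA.
rewrite -!big_split /=; congr (_ + _).
  by apply: eq_bigr => i _; rewrite !coD; ring.
by case: eps; rewrite ?addr0 // !coD; ring.
Qed.

Lemma polarD x y z : polar (x + y) z = polar x z + polar y z.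
Proof.
rewrite /polar addrACA -big_split /=; congr (_ + _).
  by apply: eq_bigr => i _; rewrite !coD; ring.
by case: eps; rewrite ?addr0 // !coD; ring.
Qed.

Lemma polarZ a x y : polar (a *: x) y = a * polar x y.
Proof.
rewrite /polar [RHS]mulrDr mulr_sumr; congr (_ + _).
  by apply: eq_bigr => i _; rewrite !coZ; ring.
by case: eps; rewrite ?mulr0 // !coZ; ring.
Qed.

Lemma planes_le : (planes <= m)%N.
Proof. by rewrite /planes; case: eps => //; lia. Qed.

Lemma polar_e x k : (0 < k <= 2 * planes)%N ->
  polar x (e k) = co x (if odd k then k.+1 else k.-1).
Proof.
move=> k_hyp; have le_m := planes_le.
have hE : (uphalf k \in index_iota 1 planes.+1) by rewrite mem_index_iota; lia.
rewrite /polar (bigD1_seq _ hE (iota_uniq _ _)) /= big1_seq ?addr0; last first.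
  move=> i /andP[ik]; rewrite mem_index_iota => i_bd.
  by rewrite !co_e_neq ?mulr0 ?addr0 //; lia.
rewrite [X in _ + X](_ : _ = 0) ?addr0; last first.
  rewrite /planes in k_hyp *; case: eps k_hyp => // k_hyp.
  by rewrite !co_e_neq ?mulr0 ?addr0 ?mulr0 //; lia.
case: ifP => odd_k.
  have -> : (2 * uphalf k = k.+1)%N by lia.
  rewrite subn1 /= co_e_id ?co_e_neq; [|lia..].
  by rewrite mulr1 mulr0 add0r.
have -> : (2 * uphalf k = k)%N by lia.
rewrite subn1 co_e_id ?co_e_neq; [|lia..].
by rewrite mulr1 mulr0 addr0.
Qed.

Lemma Qform_e k : (0 < k <= 2 * planes)%N -> Q (e k) = 0.
Proof.
move=> k_hyp; have le_m := planes_le; rewrite QformE big1_seq ?add0r.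
  rewrite /planes in k_hyp *; case: eps k_hyp => // k_hyp.
  by rewrite !co_e_neq ?expr0n ?mulr0 ?addr0 //; lia.
move=> i; rewrite mem_index_iota => i_bd; rewrite !co_e; [|lia..].
rewrite -natrM mulnb.
by rewrite (_ : (_ && _) = false) //; lia.
Qed.

Lemma Qform_A_mx x alpha : (2 <= planes)%N -> Q (x *m A_mx m alpha) = Q x.
Proof.
move=> h2; have Q1 : Q (e 1) = 0 by rewrite Qform_e //; lia.
have Q3 : Q (e 3) = 0 by rewrite Qform_e //; lia.
have P1 y : polar y (e 1) = co y 2 by rewrite polar_e //; lia.
have P3 y : polar y (e 3) = co y 4 by rewrite polar_e //; lia.
have PC := polarC QformD.
have PZr a y z : polar y (a *: z) = a * polar y z by rewrite !(PC y) polarZ.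
have PDr y z w : polar y (z + w) = polar y z + polar y w by rewrite !(PC y) polarD.
rewrite mul_A_mx QformD QformZ QformD -scaleNr !QformZ Q1 Q3.
rewrite !(PZr, PDr, polarZ) P1 !P3 !co_e; [|lia..].
by rewrite /=; ring.
Qed.

(** Odd hyperbolic coordinates are scaled by [c].  On the anisotropic plane,
    seen as the quadratic extension with norm form [x ^ 2 + b y ^ 2], the map is
    multiplication by the element [(s, t)], whose norm must then be [c]. *)
Definition similitude_co c s t x k : F :=
  if (k <= 2 * planes)%N then if odd k then c * co x k else co x k
  else if odd k then s * co x k - b * t * co x k.+1
  else t * co x k.-1 + s * co x k.

Definition similitude c s t x : V := \row_j similitude_co c s t x j.+1.

Lemma co_similitude c s t x k : (0 < k <= 2 * m)%N ->
  co (similitude c s t x) k = similitude_co c s t x k.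
Proof. exact: co_row. Qed.

Lemma similitudeD c s t : {morph similitude c s t : x y / x + y}.
Proof.
move=> x y; apply/rowP=> j; rewrite !mxE /similitude_co !coD.
by case: ifP => _; case: ifP => _; ring.
Qed.

Lemma Qform_similitude c s t x : (eps = Minus -> c = s ^+ 2 + b * t ^+ 2) ->
  Q (similitude c s t x) = c * Q x.
Proof.
move=> cE; have le_m := planes_le; rewrite !QformE mulrDr; congr (_ + _).
  rewrite mulr_sumr; apply: eq_big_seq => i; rewrite mem_index_iota => i_bd.
  rewrite !co_similitude; [|lia..]; rewrite /similitude_co.
  have -> : (2 * i - 1 <= 2 * planes)%N by lia.
  have -> : (2 * i <= 2 * planes)%N by lia.
  have -> : odd (2 * i - 1) by lia.
  have -> : odd (2 * i) = false by lia.
  by rewrite mulrA.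
have [->|eE] : eps = Plus \/ eps = Minus by case: eps; [left|right].
  by rewrite mulr0.
have E : planes = m.-1 by rewrite /planes eE.
rewrite (cE eE) eE !co_similitude; [|lia..].
rewrite /similitude_co E ifF; last by lia.
rewrite ifT; last by lia.
rewrite ifF; last by lia.
rewrite (_ : odd (2 * m) = false); last by lia.
have -> : (2 * m - 1).+1 = (2 * m)%N by lia.
have -> : (2 * m).-1 = (2 * m - 1)%N by lia.
ring.
Qed.

Hypotheses (two_neq0 : (2%:R : F) != 0) (b_neq0 : eps = Minus -> b != 0).

Lemma polar_nondegenerate x : x != 0 -> exists y, polar x y != 0.
Proof.
move=> x0; have [k k_bd xk] : exists2 k, (0 < k <= 2 * m)%N & co x k != 0.
  have [j xj] : exists j, x 0 j != 0.
    apply/existsP; apply: contraNT x0 => /existsPn x0; apply/eqP/rowP=> j.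
    by rewrite mxE; apply/eqP; rewrite -[_ == _]negbK.
  by exists j.+1; rewrite ?co_entry //= ltn_ord.
have [k_hyp|k_aniso] := leqP k (2 * planes).
  have [odd_k|even_k] := boolP (odd k).
    by exists (e k.+1); rewrite polar_e /= ?odd_k //; lia.
  exists (e k.-1); rewrite polar_e; last by lia.
  by rewrite ifT ?prednK //; lia.
have eE : eps = Minus by rewrite /planes in k_aniso; case: eps k_aniso => //; lia.
exists (e k); rewrite /polar big1_seq ?add0r; last first.
  move=> i; rewrite mem_index_iota => /= i_bd; have le_m := planes_le.
  by rewrite !co_e_neq ?mulr0 ?addr0 //; lia.
have b0 := b_neq0 eE; move: k_aniso; rewrite /planes eE => k_aniso.
have [Ek|Ek] : k = (2 * m - 1)%N \/ k = (2 * m)%N by lia.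
  rewrite -Ek co_e_id ?co_e_neq; [|lia..].
  by rewrite !mulr0 addr0 mulr1 mulf_neq0.
rewrite -Ek co_e_id ?co_e_neq; [|lia..].
by rewrite mulr0 add0r mulr1 !mulf_neq0.
Qed.

End TheForm.

(** * The group as a regular group of isometries *)

Section RegularGroup.

Variables (F : finFieldType) (m : nat).
Local Notation V := 'rV[F]_(2 * m).
Local Notation e := (e F m).
Implicit Types (u v w : V) (alpha beta : F).

Hypothesis m_ge2 : (2 <= m)%N.

Definition vec (g : agl F (2 * m)) : V := (val g).2.

(** The second coordinate is fixed by every [A_alpha], so it adds up along
    products, like the parameter [alpha]; the linear part of a group element is
    thus read off its translation part. *)
Definition elt v : agl F (2 * m) :=
  @Agl F (2 * m) (A_mx m (co v 2), v) (A_mx_unit m (co v 2)).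

Lemma eltK : cancel elt vec. Proof. by []. Qed.

Lemma elt_inj : injective elt. Proof. exact: can_inj eltK. Qed.

Lemma co_mul_A_mx v alpha k : (1 < k <= 2 * m)%N -> k != 3%N ->
  co (v *m A_mx m alpha) k = co v k.
Proof.
move=> k_bd k3; rewrite mul_A_mx -scaleN1r !(coD, coZ) !co_e; [|lia..].
by rewrite (_ : (k == 1%N) = false) ?(negPf k3); [rewrite /=; ring | lia].
Qed.

Lemma A_mxD alpha beta :
  A_mx m (alpha + beta) = A_mx m alpha *m A_mx m beta :> 'M[F]_(2 * m).
Proof.
apply/row_matrixP=> i; rewrite row_mul !rowE !mul_A_mx.
set x := delta_mx 0 i; rewrite -!scaleN1r !(coD, coZ) !co_e; [|lia..].
apply/rowP=> j; rewrite !mxE /=; ring.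
Qed.

Lemma eltM v w : (elt v * elt w)%g = elt (v *m A_mx m (co w 2) + w).
Proof.
apply: val_inj; rewrite /= coD co_mul_A_mx //; last lia.
by rewrite A_mxD.
Qed.

Lemma A_mx0 : A_mx m 0 = 1%:M :> 'M[F]_(2 * m).
Proof. by rewrite A_mxE scale0r addr0. Qed.

Lemma elt0 : elt 0 = 1%g.
Proof.
apply: val_inj; rewrite /= (_ : co 0 2 = 0) ?A_mx0 //.
by rewrite /co big1 // => j _; rewrite mxE.
Qed.

Lemma b_eltE alpha beta : b_elt m alpha beta = elt (alpha *: e 2 + beta *: e 3).
Proof.
apply: val_inj; rewrite /= coD !coZ !co_e; [|lia..].
by rewrite /= mulr1 mulr0 addr0.
Qed.

Lemma translationE u : co u 2 = 0 -> translation u = elt u.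
Proof. by move=> u2; apply: val_inj; rewrite /= u2 A_mx0. Qed.

Lemma mem_Uspace u : (u \in Uspace F m) = (co u 2 == 0) && (co u 3 == 0).
Proof.
apply/idP/andP=> [uU | [/eqP u2 /eqP u3]].
  pose X := [seq e i | i <- iota 1 (2 * m) & i \notin [:: 2; 3]%N].
  rewrite (@coord_span _ _ _ (in_tuple X) u uU).
  suff co0 k : k \in [:: 2; 3]%N -> co (\sum_i coord (in_tuple X) i u *: X`_i) k = 0.
    by rewrite !co0.
  move=> k23; have coS := big_morph (fun x : V => co x k) (fun x y => coD x y k).
  rewrite (coS 0); last by rewrite /co big1 // => j _; rewrite mxE.
  apply: big1 => i _; rewrite coZ; have: X`_i \in X by rewrite mem_nth.
  case/mapP=> l; rewrite mem_filter => /andP[l23 _] ->.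
  rewrite co_e; last by move: k23; rewrite !inE => /orP[] /eqP->; lia.
  by case: eqP => [E|]; rewrite ?mulr0 //; rewrite -E k23 in l23.
have -> : u = \sum_(j < 2 * m) co u j.+1 *: e j.+1.
  apply/rowP=> i; rewrite summxE (bigD1 i) //= big1 ?addr0; last first.
    by move=> j /negPf; rewrite -val_eqE !mxE eqSS eq_sym /= => ->; rewrite mulr0.
  by rewrite !mxE eqxx mulr1 co_entry.
apply: memv_suml => j _.
have [j23|j23] := boolP (j.+1 \in [:: 2; 3]%N).
  by move: j23; rewrite !inE => /orP[] /eqP ->; rewrite ?u2 ?u3 scale0r mem0v.
apply/memvZ/memv_span/map_f; rewrite mem_filter j23 mem_iota.
by case: j {j23} => j /=; lia.
Qed.

Lemma T_group_set (n : nat) (U : {vspace 'rV[F]_n}) : group_set (T_ U).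
Proof.
apply/group_setP; split.
  by apply/imsetP; exists 0; rewrite ?mem0v //; apply: val_inj.
move=> _ _ /imsetP[u Uu ->] /imsetP[w Uw ->]; apply/imsetP.
by exists (u + w); [rewrite memvD | apply: val_inj; rewrite /= !mulmx1].
Qed.

Canonical T_group n (U : {vspace 'rV[F]_n}) := Group (T_group_set U).

Lemma BgrpE : Bgrp F m = [set b_elt m alpha beta | alpha : F, beta : F] :> {set _}.
Proof.
apply: gen_set_id; apply/group_setP; split.
  apply/imset2P; exists 0 0 => //; by rewrite b_eltE !scale0r addr0 elt0.
move=> _ _ /imset2P[a1 b1 _ _ ->] /imset2P[a2 b2 _ _ ->]; apply/imset2P.
(* The matrix [A_(a2)] sends [e 2] to [e 2 - a2 e 3]. *)
exists (a1 + a2) (b1 + b2 - a1 * a2) => //.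
rewrite !b_eltE eltM; congr elt.
rewrite mul_A_mx -scaleN1r !(coD, coZ) !co_e; [|lia..].
apply/rowP=> j; rewrite !mxE /=; ring.
Qed.

Lemma mem_Bgrp v : co v 2 *: e 2 + co v 3 *: e 3 = v -> elt v \in Bgrp F m.
Proof.
by move=> Ev; rewrite -Ev -b_eltE BgrpE; apply: imset2_f.
Qed.

Lemma Bgrp_norm : Bgrp F m \subset 'N(T_ (Uspace F m))%g.
Proof.
apply/subsetP=> _ /[1!BgrpE] /imset2P[a b _ _ ->]; rewrite inE.
apply/subsetP=> _ /imsetP[_ /imsetP[u /[1!mem_Uspace] /andP[/eqP u2 /eqP u3] ->] ->].
apply/imsetP; exists (u *m A_mx m a).
  rewrite mem_Uspace co_mul_A_mx ?u2 ?eqxx //=; last lia.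
  rewrite mul_A_mx -scaleN1r !(coD, coZ) !co_e ?u2 ?u3; [|lia..].
  by apply/eqP; rewrite /=; ring.
apply: (mulgI (b_elt m a b)); rewrite -conjgC; apply: val_inj => /=.
by rewrite mulmx1 mul1mx mulmx1 addrC.
Qed.

Lemma T_Bgrp_trivial : (T_ (Uspace F m) :&: Bgrp F m = 1)%g.
Proof.
apply/trivgP/subsetP=> _ /setIP[/imsetP[u /[1!mem_Uspace] /andP[/eqP u2 /eqP u3] ->]].
rewrite translationE // BgrpE => /imset2P[a b _ _] /[1!b_eltE] /elt_inj Eu.
have: co u 2 = a by rewrite Eu !(coD, coZ) !co_e; [|lia..]; rewrite /=; ring.
have: co u 3 = b by rewrite Eu !(coD, coZ) !co_e; [|lia..]; rewrite /=; ring.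
by rewrite u2 u3 => b0 a0; rewrite Eu -a0 -b0 !scale0r addr0 elt0 inE.
Qed.

Lemma G2_mulE : G2 F m = (T_ (Uspace F m) * Bgrp F m)%g :> {set _}.
Proof. exact: (norm_joinEr Bgrp_norm). Qed.

Lemma G2_sdprod : (T_ (Uspace F m) ><| Bgrp F m = G2 F m)%g.
Proof. by rewrite G2_mulE; apply: sdprodE Bgrp_norm T_Bgrp_trivial. Qed.

Lemma G2E : G2 F m = [set elt v | v : V] :> {set _}.
Proof.
rewrite G2_mulE; apply/setP=> g; apply/idP/imsetP=> [|[v _ ->]].
  case/mulsgP=> _ h /imsetP[u /[1!mem_Uspace] /andP[/eqP u2 _] ->].
  rewrite BgrpE translationE // => /imset2P[a b _ _ ->] ->.
  by rewrite b_eltE eltM; eexists.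
rewrite -(normC Bgrp_norm).
pose w := co v 2 *: e 2 + co v 3 *: e 3.
have w2 : co w 2 = co v 2 by rewrite !(coD, coZ) !co_e; [|lia..]; rewrite /=; ring.
have w3 : co w 3 = co v 3 by rewrite !(coD, coZ) !co_e; [|lia..]; rewrite /=; ring.
have d2 : co (v - w) 2 = 0 by rewrite -scaleN1r coD coZ w2; ring.
have d3 : co (v - w) 3 = 0 by rewrite -scaleN1r coD coZ w3; ring.
have -> : elt v = (elt w * translation (v - w))%g.
  by rewrite translationE // eltM d2 A_mx0 mulmx1 addrC subrK.
rewrite mem_mulg //; first by apply: mem_Bgrp; rewrite w2 w3.
by apply: imset_f; rewrite mem_Uspace d2 d3 eqxx.
Qed.

Lemma mem_elt v : elt v \in G2 F m. Proof. by rewrite G2E imset_f. Qed.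

Lemma vecK : {in G2 F m, cancel vec elt}.
Proof. by move=> _ /[1!G2E] /imsetP[v _ ->]. Qed.

Lemma card_G2 : #|G2 F m| = (#|F| ^ (2 * m))%N.
Proof. by rewrite G2E (card_imset _ elt_inj) card_mx mul1n. Qed.

Lemma G2_nonabelian : ~~ abelian (G2 F m).
Proof.
(* Translation by [e 4] does not commute with [elt (e 2)], whose linear part
   moves [e 4] to [e 4 + e 1]. *)
apply/negP=> /centsP/(_ _ (mem_elt (e 2)) _ (mem_elt (e 4))).
rewrite /commute !eltM => /elt_inj; rewrite !mul_A_mx !co_e; [|lia..].
rewrite /= => /(congr1 (fun x => co x 1)).
rewrite -!scaleN1r !(coD, coZ) !co_e; [|lia..]; rewrite /=.
by move/eqP; rewrite !(mulr0, mul0r, mulr1, addr0, add0r, scale0r) eq_sym oner_eq0.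
Qed.

End RegularGroup.

(** * Difference sets and their Cayley graphs *)

Section DifferenceSets.

Variables (F : finFieldType) (m : nat) (eps : sign) (b : F).
Local Notation V := 'rV[F]_(2 * m).
Local Notation e := (e F m).
Local Notation Q := (Qform eps b : V -> F).
Implicit Types (u v w : V) (P : {set F}).

Hypotheses (m_ge2 : (2 <= m)%N) (planes_ge2 : (2 <= planes m eps)%N).

(** The identity is excluded explicitly because [P] may contain 0. *)
Definition diffset P : {set agl F (2 * m)} :=
  [set g in G2 F m | (g != 1%g) && (Q (vec g) \in P)].

Lemma elt_eq1 v : (elt v == 1%g) = (v == 0).
Proof. by rewrite -elt0 (inj_eq (@elt_inj _ _)). Qed.

(** The translation part of the quotient is [v - w] moved by the inverse of the
    linear part of [elt w], which is an isometry. *)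
Lemma quotient_diffset P v w :
  ((elt v * (elt w)^-1)%g \in diffset P) = (v != w) && (Q (v - w) \in P).
Proof.
rewrite inE groupM ?groupV ?mem_elt //= -eq_mulgV1 (inj_eq (@elt_inj _ _)).
congr (_ && (_ \in P)).
set A := A_mx m (co w 2).
have -> : vec (elt v * (elt w)^-1)%g = (v - w) *m invmx A.
  by rewrite /vec /= mulmxBl.
by rewrite -[LHS](Qform_A_mx b m_ge2 _ (co w 2)) // mulmxKV ?A_mx_unit.
Qed.

Lemma inv_elt_diffset P w : ((elt w)^-1%g \in diffset P) = (w != 0) && (Q w \in P).
Proof.
rewrite -[(_^-1)%g]mul1g -elt0 // quotient_diffset eq_sym sub0r.
by rewrite (quadN (@QformZ _ _ eps b m_ge2)).
Qed.

Lemma elt_diffset P v : (elt v \in diffset P) = (v != 0) && (Q v \in P).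
Proof. by rewrite inE mem_elt // elt_eq1. Qed.

(** Writing the second factor as the inverse of [elt w] makes the first one
    [elt v * (elt w)^-1], so that the quotients become common neighbours of 0 and
    [v] in the graph on the vector space. *)
Lemma num_quotients_diffset P v :
  num_quotients (diffset P) (elt v) =
  #|[set w | [&& w != 0, w != v, Q w \in P & Q (v - w) \in P]]|.
Proof.
pose f w := ((elt v * (elt w)^-1)%g, (elt w)^-1%g).
have f_inj : injective f by move=> w w' E; apply/elt_inj/invg_inj/(congr1 snd E).
rewrite -(card_imset _ f_inj); apply: eq_card => -[d1 d2].
rewrite inE in_setX /=; apply/andP/imsetP=> [[/andP[D1 D2] /eqP Ev]|[w wP [-> ->]]].
  have Gd2 : d2^-1%g \in G2 F m by rewrite groupV; move: D2; rewrite inE => /andP[].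
  have E2 : d2 = (elt (vec d2^-1%g))^-1%g by rewrite vecK // invgK.
  have E1 : d1 = (elt v * (elt (vec d2^-1))^-1)%g by rewrite vecK // invgK -Ev mulgKV.
  exists (vec d2^-1%g); last by rewrite /f -E1 -E2.
  move: D1; rewrite E1 quotient_diffset.
  have: (elt (vec d2^-1%g))^-1%g \in diffset P by rewrite -E2.
  rewrite inv_elt_diffset inE => /andP[w0 Qw] /andP[n1 Qvw].
  by rewrite w0 Qw Qvw eq_sym n1.
move: wP; rewrite inE => /and4P[w0 wv Qw Qvw]; split; last by rewrite mulgK.
by rewrite /= quotient_diffset inv_elt_diffset w0 Qw Qvw eq_sym wv.
Qed.

Definition cay_vec (g : subg_of (G2 F m)) : V := vec (sgval g).

Lemma cay_vec_bij : bijective cay_vec.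
Proof.
exists (fun v => subg (G2 F m) (elt v)) => [g|v].
  by rewrite /cay_vec vecK ?subgP // sgvalK.
by rewrite /cay_vec subgK ?mem_elt.
Qed.

Lemma Cay_diffset P g h : Cay (G2 F m) (diffset P) g h =
  (cay_vec g != cay_vec h) && (Q (cay_vec g - cay_vec h) \in P).
Proof.
by rewrite /Cay -quotient_diffset /cay_vec !vecK ?subgP.
Qed.

End DifferenceSets.

(** * Strong regularity *)

Lemma graph_iso_sym (T1 T2 : Type) (e1 : rel T1) (e2 : rel T2) :
  graph_iso e1 e2 -> graph_iso e2 e1.
Proof.
case=> f [g fK gK] fE; exists g; first by exists f.
by move=> x y; rewrite fE !gK.
Qed.

Lemma graph_iso_trans (T1 T2 T3 : Type) (e1 : rel T1) (e2 : rel T2) (e3 : rel T3) :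
  graph_iso e1 e2 -> graph_iso e2 e3 -> graph_iso e1 e3.
Proof.
case=> f f_bij fE [g g_bij gE]; exists (g \o f); first exact: bij_comp.
by move=> x y; rewrite fE gE.
Qed.

Section Regularity.

Variables (F : finFieldType) (m : nat) (eps : sign) (b : F).
Local Notation V := 'rV[F]_(2 * m).
Local Notation e := (e F m).
Local Notation Q := (Qform eps b : V -> F).
Local Notation G := (G2 F m).
Local Notation diffset := (diffset m eps b).
Implicit Types (u v w : V) (P : {set F}).

Hypotheses (m_ge2 : (2 <= m)%N) (planes_ge2 : (2 <= planes m eps)%N).
Lemma diffset_disjoint P P' : [disjoint P & P'] -> [disjoint diffset P & diffset P'].
Proof.
move=> dis; rewrite -setI_eq0 -subset0; apply/subsetP=> g.
rewrite !inE => /andP[/and3P[_ _ Pg] /and3P[_ _]].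
by rewrite (disjointFr dis Pg).
Qed.

Lemma diffset_neq0 P a : a \in P -> diffset P != set0.
Proof.
move=> Pa; apply/set0Pn; exists (elt (a *: e 1 + e 2)).
have QE : Q (a *: e 1 + e 2) = a.
  rewrite (QformD eps b m_ge2) QformZ // !Qform_e; [|lia..].
  by rewrite polarZ polar_e ?co_e_id /=; [ring|lia..].
rewrite elt_diffset // QE Pa andbT.
apply: contraTneq isT => /(congr1 (fun x => co x 2)).
rewrite coD coZ co_e_neq ?co_e_id; [|lia..].
by rewrite mulr0 add0r /co big1 => [/eqP|j _]; rewrite ?oner_eq0 ?mxE.
Qed.

Definition quad_graph P : rel V := fun v w => (v != w) && (Q (v - w) \in P).

Lemma graph_iso_Cay P : graph_iso (Cay G (diffset P)) (quad_graph P).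
Proof.
exists (@cay_vec F m); first exact: cay_vec_bij.
by move=> g h; apply: Cay_diffset.
Qed.

Hypotheses (two_neq0 : (2%:R : F) != 0) (nsq_b : eps = Minus -> ~~ is_square (- b)).

Lemma b_neq0 : eps = Minus -> b != 0.
Proof.
by move/nsq_b; apply: contraNneq => ->; rewrite oppr0 is_square0.
Qed.

(** For [Minus] the multiplier of a similitude must be a value of the anisotropic
    form, whence the pair [(s, t)]. *)
Lemma multiplier_exists : exists c s t : F,
  ~~ is_square c /\ (eps = Minus -> c = s ^+ 2 + b * t ^+ 2).
Proof.
case: eps nsq_b => [_|/(_ erefl)/nonsquare_norm [s [t nc]]].
  by have [c nc] := exists_nonsquare two_neq0; exists c, 0, 0.
by exists (s ^+ 2 + b * t ^+ 2), s, t.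
Qed.

Lemma Q_similitude_inj c s t : ~~ is_square c ->
  (eps = Minus -> c = s ^+ 2 + b * t ^+ 2) ->
  injective (similitude eps b c s t : V -> V).
Proof.
move=> /nonsquare_neq0 c0 cE.
have nondeg := polar_nondegenerate m_ge2 two_neq0 b_neq0.
apply: (similitude_inj (QformD eps b m_ge2) (polarZ eps b) nondeg c0) => [|x].
  exact: similitudeD.
  exact: Qform_similitude.
Qed.

(** A similitude with nonsquare multiplier carries nonsquare values of [Q] to
    nonzero squares. *)
Lemma quad_graph_swap :
  graph_iso (quad_graph (nonsquares F)) (quad_graph (nzsquares F)).
Proof.
have [c [s [t [nc cE]]]] := multiplier_exists; have c0 := nonsquare_neq0 nc.
have inj := Q_similitude_inj nc cE.
exists (similitude eps b c s t); first exact: injF_bij.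
move=> v w; rewrite /quad_graph (inj_eq inj); congr (_ && _).
have -> : similitude eps b c s t v - similitude eps b c s t w =
          similitude eps b c s t (v - w).
  by rewrite -{1}[v](subrK w) [X in X - _]similitudeD addrK.
rewrite Qform_similitude // !inE mulf_eq0 (negPf c0) /=.
have [->|Q0] := eqVneq (Q (v - w)) 0; first by rewrite is_square0.
by rewrite is_squareM // (negPf nc); case: (is_square _).
Qed.

Definition neighbours P v : nat :=
  #|[set w | [&& w != 0, w != v, Q w \in P & Q (v - w) \in P]]|.

(** The count over all [w] exceeds the number of common neighbours by the two
    vectors 0 and [v], which satisfy the conditions together or not at all. *)
Lemma neighboursE P v : v != 0 ->
  (neighbours P v + 2 * ((0%R \in P) && (Q v \in P)))%N =
  #|[set w | (Q w \in P) && (Q (v - w) \in P)]|.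
Proof.
move=> v0; set X := [set w | (Q w \in P) && (Q (v - w) \in P)].
have Q0 : Q 0 = 0 := quad0 (QformZ eps b m_ge2).
have X0 : (0 \in X) = (0 \in P) && (Q v \in P) by rewrite inE Q0 subr0.
have Xv : (v \in X) = (0 \in P) && (Q v \in P) by rewrite inE subrr Q0 andbC.
rewrite (cardsD1 0 X) (cardsD1 v (X :\ 0)) in_setD1 v0 X0 Xv addnA.
rewrite addnC mul2n -addnn; congr (_ + _)%N; apply: eq_card => w.
by rewrite !inE; case: (w == 0); case: (w == v).
Qed.

Lemma neighbours_splittings P : exists n0 n1 : nat, forall v, v != 0 ->
  neighbours P v = (n0 * #|splittings P (Q v)|
    + n1 * (#|P| * #|P| * #|F| - #|splittings P (Q v)|)
    - 2 * ((0%R \in P) && (Q v \in P)))%N.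
Proof.
have [c [s [t [nc cE]]]] := multiplier_exists.
have QZ := QformZ eps b m_ge2; have QD := QformD eps b m_ge2.
pose l := level Q (polar eps b) (e 1) (e 2).
exists (l 0), (l 1) => v v0.
rewrite -[LHS](addnK (2 * ((0 \in P) && (Q v \in P)))) neighboursE //.
congr (_ - _)%N.
have pe1 x : polar eps b x (e 1) = co x 2 by rewrite polar_e //; lia.
have pe2 x : polar eps b x (e 2) = co x 1 by rewrite polar_e //; lia.
have nondeg := polar_nondegenerate m_ge2 two_neq0 b_neq0.
have Q1 : Q (e 1) = 0 by rewrite Qform_e //; lia.
have P12 : polar eps b (e 1) (e 2) = 1 by rewrite pe2 co_e_id //; lia.
apply: (card_quad_pairs QZ QD (polarD eps b) (polarZ eps b) nondeg Q1 P12 nc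
         two_neq0 (Q_similitude_inj nc cE)) => // x.
- exact: Qform_similitude.
- rewrite !pe1 co_similitude /similitude_co; [|lia].
  by rewrite ifT //; lia.
- rewrite !pe2 co_similitude /similitude_co; [|lia].
  by rewrite ifT /= ?mulf_eq0 ?(negPf (nonsquare_neq0 nc)) //; lia.
Qed.

Lemma PDS_diffset P : splitting_regular P -> is_PDS G (diffset P).
Proof.
case=> n1 [n2 [n1E n2E]]; have [l0 [l1 nE]] := neighbours_splittings P.
pose N n k := (l0 * n + l1 * (#|P| * #|P| * #|F| - n) - 2 * k)%N.
exists #|G|, #|diffset P|, (N n1 (0%R \in P)), (N n2 0); split.
- by split=> //; apply/subsetP=> g /[!inE] /andP[].
- move=> g Dg g1; have Gg : g \in G by move: Dg; rewrite inE => /andP[].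
  move: Dg g1; rewrite -(vecK m_ge2 Gg) elt_diffset // elt_eq1 // => /andP[_ Qg] v0.
  by rewrite num_quotients_diffset // -[LHS]/(neighbours _ _) nE // n1E // Qg andbT.
- move=> g /setDP[Gg Dg] g1; move: Dg g1.
  rewrite -(vecK m_ge2 Gg) elt_diffset // elt_eq1 // => nD v0.
  move: nD; rewrite v0 /= => Qg.
  rewrite num_quotients_diffset // -[LHS]/(neighbours _ _) nE // n2E //.
  by rewrite (negPf Qg) andbF.
- split; first by rewrite inE eqxx andbF.
  apply/setP=> g; rewrite mem_invg.
  have [Gg|nG] := boolP (g \in G).
    by rewrite -(vecK m_ge2 Gg) inv_elt_diffset // elt_diffset.
  by rewrite !inE groupV (negPf nG).
Qed.

End Regularity.

Theorem theorem3p7 (p r q : nat) (F : finFieldType) (m : nat) (eps : sign) (b : F)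
  (hp : prime p) (hodd : odd p) (hr : (0 < r)%N) (hq : q = (p ^ r)%N)
  (hF : #|F| = q)
  (hm : (2 <= m)%N)
  (hb : eps = Minus -> ~~ is_square (- b)%R)
  (hcase : (2 < m)%N \/ (m = 2%N /\ eps = Plus)) :
  [/\ (T_ (Uspace F m) ><| Bgrp F m = G2 F m)%g,
      ~~ abelian (G2 F m),
      #|G2 F m| = (q ^ (2 * m))%N
    & exists D0 D1 D2 : {set agl F (2 * m)},
        [/\ uniq [:: D0; D1; D2] /\ partition [set D0; D1; D2] (G2 F m)^#%g,
            [/\ is_PDS (G2 F m) D0, is_PDS (G2 F m) D1 & is_PDS (G2 F m) D2],
            graph_iso (Cay (G2 F m) D0) (VO m eps b),
            graph_iso (Cay (G2 F m) D1) (Cay (G2 F m) D2)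
          & graph_iso (Cay (G2 F m) D2) (VNO m eps b)]].
Proof.
have planes_ge2 : (2 <= planes m eps)%N.
  by rewrite /planes; case: hcase => [|[-> ->] //]; case: (eps); lia.
have two_neq0 : (2%:R : F) != 0.
  have charFp : p \in [pchar F]%R by apply: (@card_finPcharP _ _ r); rewrite // hF.
  apply/negP=> /eqP two0; have: 2%N \in [pchar F]%R by rewrite inE /= two0 eqxx.
  by rewrite (pcharf_eq charFp) inE => /eqP E; move: hodd; rewrite -E.
split; first exact: G2_sdprod.
- exact: G2_nonabelian.
- by rewrite card_G2 // hF.
pose D := diffset m eps b.
pose D0 := D [set 0%R]; pose D1 := D (nonsquares F); pose D2 := D (nzsquares F).
exists D0, D1, D2.
have d01 : [disjoint D0 & D1].
  apply: diffset_disjoint; rewrite disjoints1 inE negbK; exact: is_square0.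
have d02 : [disjoint D0 & D2].
  by apply: diffset_disjoint; rewrite disjoints1 inE eqxx.
have d12 : [disjoint D1 & D2].
  apply: diffset_disjoint; rewrite -setI_eq0 -subset0; apply/subsetP=> a.
  by rewrite !inE => /and3P[/negPf->].
have [c nc] := exists_nonsquare two_neq0.
have n0 : D0 != set0 by apply: (diffset_neq0 b hm planes_ge2 (a := 0%R)); rewrite inE.
have n1 : D1 != set0 by apply: (diffset_neq0 b hm planes_ge2 (a := c)); rewrite inE.
have n2 : D2 != set0.
  by apply: (diffset_neq0 b hm planes_ge2 (a := 1%R)); rewrite inE oner_eq0 is_square1.
have neqD (A B : {set agl F (2 * m)}) : A != set0 -> [disjoint A & B] -> A != B.
  by move=> A0; apply: contraTneq => <-; rewrite -setI_eq0 setIid.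
split.
- split.
    rewrite /= !inE negb_or (neqD _ _ n0 d01) (neqD _ _ n0 d02).
    by rewrite (neqD _ _ n1 d12).
  apply/and3P; split.
  + apply/eqP/setP=> g; rewrite /cover bigcup_setU bigcup_setU !big_set1 !inE.
    case: (g \in G2 F m); rewrite ?andbF //= !andbT.
    case: (g != 1%g) => //=.
    have [->|Q0] := eqVneq (Qform eps b (vec g)) 0%R; first by rewrite is_square0.
    by case: (is_square _).
  + apply/trivIsetP=> A B; rewrite !inE.
    by move=> /orP[/orP[]|] /eqP-> /orP[/orP[]|] /eqP->;
      rewrite ?eqxx // disjoint_sym.
  + by rewrite !inE !(eq_sym set0) !negb_or n0 n1 n2.
- split; apply: PDS_diffset => //.
  + exact: splitting_regular_zero.
  + exact: splitting_regular_nonsquares.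
  + exact: splitting_regular_nzsquares.
- case: (graph_iso_Cay b hm planes_ge2 [set 0%R]) => f f_bij fE; exists f => // g h.
  by rewrite fE /quad_graph inE.
- apply: graph_iso_trans (graph_iso_Cay b hm planes_ge2 _) _.
  apply: graph_iso_trans (quad_graph_swap _ _ _) _ => //.
  exact/graph_iso_sym/graph_iso_Cay.
- case: (graph_iso_Cay b hm planes_ge2 (nzsquares F)) => f f_bij fE; exists f => // g h.
  by rewrite fE /quad_graph inE.
Qed.
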